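(* Let $H$ be a hypergraph and let $U,V\subseteq V(H)$ be disjoint subsets of vertices. The pair $U,V$ is an equal partition of hyperedges in $H$ if and only if $B_H(\chi_U-\chi_V)=0$.
   Context: A hypergraph $H$ is a pair $(V(H),E(H))$ with $V(H)$ a non-empty finite set (vertices) and $E(H)$ a set of non-empty subsets of $V(H)$ (hyperedges). The edge-vertex incidence matrix $B_H=[b_{ev}]_{e\in E(H),v\in V(H)}$ has $b_{ev}=1$ if $v\in e$ and $b_{ev}=0$ otherwise; for a vector $x:V(H)\to\mathbb{C}$, $(B_Hx)(e)=\sum_{v\in e}x(v)$. For $U\subseteq V(H)$, $\chi_U:V(H)\to\{0,1\}$ is the characteristic function of $U$. Two disjoint subsets $U,V$ of $V(H)$ are called an equal partition of hyperedges in $H$ if $|U\cap e|=|V\cap e|$ for all $e\in E(H)$. *)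

(* Defs.v *)
From mathcomp Require Import all_boot all_order all_algebra.
From mathcomp Require Import reals complex.

Set Implicit Arguments.
Unset Strict Implicit.
Unset Printing Implicit Defensive.

Local Open Scope ring_scope.

Record hypergraph := Hypergraph {
  vertex : finType;
  hyperedges : {set {set vertex}};
  vertex_nonempty : (0 < #|{: vertex}|)%N;
  hyperedge_nonempty : forall e, e \in hyperedges -> e != set0
}.

(* For R : realType, complex R is the field of complex numbers.  Rows stand for
   hyperedges and columns for vertices, through the enumeration enum_val. *)
Definition incidence (R : realType) (H : hypergraph) :
    'M[complex R]_(#|hyperedges H|, #|{: vertex H}|) :=
  \matrix_(i, j) ((enum_val j : vertex H) \in (enum_val i : {set vertex H}))%:R.

Definition char_vec (R : realType) (H : hypergraph) (U : {set vertex H}) :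
    'cV[complex R]_#|{: vertex H}| :=
  \col_j ((enum_val j : vertex H) \in U)%:R.

Definition equal_partition_hyperedges (H : hypergraph) (U V : {set vertex H}) :
    Prop :=
  [disjoint U & V] /\
  forall e, e \in hyperedges H -> #|U :&: e| = #|V :&: e|.

(* Main.v *)
Require Import Defs.
From mathcomp Require Import all_boot all_order all_algebra.
From mathcomp Require Import reals complex.

(** The entry of [incidence *m char_vec U] at a hyperedge [e] is a sum of
    products of two indicators, so it counts the vertices of [U] lying in [e].
    Hence the entry of the product with [char_vec U - char_vec V] is the
    difference of the two counts, and it vanishes exactly when the counts agree
    as natural numbers, because the complex numbers have characteristic zero. *)

Import GRing.Theory Num.Theory.

Local Open Scope ring_scope.

Lemma incidence_mul_char_vec (R : realType) (H : hypergraph)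
    (U : {set vertex H}) (i : 'I_#|hyperedges H|) (k : 'I_1) :
  (incidence R H *m char_vec R U) i k = #|U :&: enum_val i|%:R.
Proof.
rewrite mxE -[in RHS]sum1_card natr_sum [RHS]big_mkcond.
under [LHS]eq_bigr do rewrite !mxE -natrM mulnb andbC -in_setI.
rewrite -(big_enum_val (fun v : vertex H => (v \in U :&: enum_val i)%:R)).
by apply: eq_bigr => v _; case: (v \in _).
Qed.

Theorem theorem2p16 (R : realType) (H : hypergraph) (U V : {set vertex H})
    (disjUV : [disjoint U & V]) :
  equal_partition_hyperedges U V <->
  incidence R H *m (char_vec R U - char_vec R V) = 0.
Proof.
rewrite mulmxBr; split=> [[_ eqUV] | /eqP].
  apply/eqP; rewrite subr_eq0; apply/eqP/matrixP=> i k.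
  by rewrite !incidence_mul_char_vec eqUV ?enum_valP.
rewrite subr_eq0 => /eqP eqBUV; split=> // e eH.
have /matrixP/(_ (enum_rank_in eH e) ord0) := eqBUV.
by rewrite !incidence_mul_char_vec enum_rankK_in // => /eqP; rewrite eqr_nat => /eqP.
Qed.
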